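(* Let $Q(t)=q_0+q_st^s+q_rt^r\in\mathbb{Z}[t]$ be a trinomial with $r>s>0$, $r>2$, and $q_0$, $q_r$ odd, and suppose that $Q(t)$ is primitive (mod 2). Let $w\ge 1$, let $x_0,\ldots,x_{r-1}$ be integers, at least one of which is odd, and let $(x_n)_{n\ge 0}$ be the sequence modulo $2^w$ with these initial values defined by $$q_0x_n+q_sx_{n+s}+q_rx_{n+r}\equiv 0\pmod{2^w}\qquad (n\ge 0).$$ Then the sequence $(x_n)$ has period $p_w=2^{w-1}(2^r-1)$.
   Context: A polynomial $Q(t)\in\mathbb{Z}[t]$ of degree $r$ with odd constant and leading coefficients is primitive (mod 2) if $\lambda=2^r-1$, where $\lambda$ is the least positive integer such that $t^\lambda=1$ in $\mathbb{Z}_2[t]/Q(t)$. (This is stronger than irreducibility of $Q(t)\bmod 2$ in $\mathbb{Z}_2[t]$.) Since $q_r$ is odd, the recurrence determines $x_n$ modulo $2^w$ uniquely for all $n\ge r$ from $x_0,\ldots,x_{r-1}$. The period $p_w$ is the least positive integer $p$ such that $x_{n+p}\equiv x_n\pmod{2^w}$ for all sufficiently large $n$ (equivalently, since $q_0$ is odd, for all $n\ge 0$). *)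

(* Defs.v *)
From mathcomp Require Import all_boot all_order all_algebra.
Set Implicit Arguments.
Unset Strict Implicit.
Unset Printing Implicit Defensive.
Import Order.TTheory GRing.Theory Num.Theory.
Local Open Scope ring_scope.

Definition least_positive (P : nat -> Prop) (p : nat) : Prop :=
  [/\ (0 < p)%N, P p & forall m : nat, (0 < m)%N -> P m -> (p <= m)%N].

Definition odd_int (a : int) : bool := odd `|a|%N.

Definition red2 (Q : {poly int}) : {poly 'F_2} :=
  map_poly (fun a : int => a%:~R) Q.

(* t^l = 1 in the quotient ring F_2[t]/(Q mod 2) *)
Definition Xpow_eq1_mod2 (Q : {poly int}) (l : nat) : Prop :=
  'X^l %% red2 Q = 1 %% red2 Q.

(* (size Q).-1 is the degree r of Q. *)
Definition primitive_mod2 (Q : {poly int}) : Prop :=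
  [/\ odd_int Q`_0, odd_int (lead_coef Q)
    & least_positive (Xpow_eq1_mod2 Q) (2 ^ (size Q).-1 - 1)%N].

Definition trinomial (q0 qs qr : int) (s r : nat) : {poly int} :=
  q0%:P + qs *: 'X^s + qr *: 'X^r.

Definition eventual_period (m : int) (x : nat -> int) (p : nat) : Prop :=
  exists N : nat, forall n : nat, (N <= n)%N -> (x (n + p)%N = x n %[mod m])%Z.

Definition has_period (m : int) (x : nat -> int) (p : nat) : Prop :=
  least_positive (eventual_period m x) p.

(* Main.v *)
From HB Require Import structures.
Require Import Defs.
From mathcomp Require Import all_boot all_order all_algebra.
From mathcomp Require Import ring zify.
Set Implicit Arguments.
Unset Strict Implicit.
Unset Printing Implicit Defensive.
Import Order.TTheory GRing.Theory Num.Theory.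
Local Open Scope ring_scope.

(** Write [t] for the variable, [l = 2 ^ r - 1] and [K] for [Q] mod 2. The
    period of [x] is governed by the order of [t] modulo [(2 ^ w, Q)].

    Since [t] has order [l] modulo [K], its powers are [2 ^ r - 1] distinct
    nonzero residues, hence all of them ([primitive_dichotomy]): the quotient
    of F_2[t] by [K] is a field. Write [t ^ l = 1 + 2 A] modulo [Q]. Squaring
    gives [t ^ (2 l) = 1 + 4 (A + A ^ 2)], and from then on each squaring raises
    the power of 2 by exactly one without changing the cofactor mod 2. So
    [t ^ (2 ^ k l) = 1 + 2 ^ (k + 1) B_k] with [B_k] nonzero mod [(2, Q)] for
    every [k], provided that [A] is neither 0 nor 1 in the field; this is
    [Xorder_pow2].

    The proviso says that [t ^ l] is neither 1 nor -1 modulo [(4, Q)], and it is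
    the only point where the trinomial shape matters
    ([Xorder_not_scalar_mod4]). Suppose [t ^ l = e] with [e] odd, and put
    [u = t ^ (2 ^ (r - 1))], so that [u ^ 2 = e t]. As iterated Frobenius fixes
    F_2, [Q(u)] vanishes modulo [(2, Q)], that is [q_s u ^ s + q_r u ^ r] is
    [- q_0] up to a multiple of 2; squaring this turns it into a relation modulo
    4 between [t ^ s], [t ^ r] and twice the cross term [u ^ (s + r)]. Together
    with [Q(t) = 0], all of its coefficients become even. Halving it and squaring
    once more mod 2 leaves a relation [b X ^ 2 + c Y ^ 2 + X Y = 0] between
    [X = t ^ s] and [Y = t ^ r = 1 + X]. Three of the four choices of [b] and [c]
    would make a power of [t] vanish; the remaining one reads [1 + X + X ^ 2 = 0],
    whence [t ^ (3 s) = 1], which is absurd because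
    [3 s <= 3 (r - 1) < 2 ^ r - 1] when [r > 2] ([quadratic_form_nonzero]).

    To transfer this to the sequence, let polynomials act by [t ^ i |-> x i].
    Those that annihilate [x] modulo [m] form an ideal, [p] is an eventual period
    exactly when some [t ^ N (t ^ p - 1)] lies in it, and as [x] has an odd term
    the annihilator modulo 2 is no larger than [(2, Q)] ([ann_two_red2]). Hence
    a period is a multiple [j l] of [l]; and if [2 ^ (w - 1)] did not divide [j],
    then [2 ^ (w - 2) l] would be a period too, so [2 ^ (w - 1) B] would
    annihilate [x] modulo [2 ^ w] for some [B] nonzero mod [(2, Q)], and [B]
    would annihilate [x] modulo 2. *)

(** * Order of the variable modulo a polynomial over a field *)

Lemma eqmodp_dvd (F : fieldType) (d p q : {poly F}) :
  p %% d = q %% d <-> d %| p - q.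
Proof.
split=> [e|]; first by apply/modp_eq0P; rewrite modpD modpN e subrr.
by move/modp_eq0P; rewrite modpD modpN => /eqP; rewrite subr_eq0 => /eqP.
Qed.

Section OrderOfX.
Variables (F : fieldType) (K : {poly F}) (l : nat).
Hypothesis (K_gt1 : (1 < size K)%N).
Hypothesis (l_ord : least_positive (fun n => 'X^n %% K = 1 %% K) l).

Lemma Xorder_gt0 : (0 < l)%N. Proof. by case: l_ord. Qed.

Lemma dvdp_Xorder m : K %| 'X^(l * m) - 1.
Proof.
have [_ /eqmodp_dvd hl _] := l_ord.
by rewrite exprM -[X in _ - X](expr1n _ m) subrXX dvdp_mulr.
Qed.

Lemma dvdp_Xsub1_order n : K %| 'X^n - 1 -> (l %| n)%N.
Proof.
move=> hn; have [l_gt0 _ l_min] := l_ord; rewrite /dvdn; apply/eqP/eqP.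
rewrite eqn0Ngt; apply/negP => m_gt0.
have /(l_min _ m_gt0) : 'X^(n %% l)%N %% K = 1 %% K.
  apply/eqmodp_dvd.
  have -> : 'X^(n %% l)%N - 1 =
      ('X^n - 1) - 'X^(n %% l)%N * ('X^(l * (n %/ l))%N - 1) :> {poly F}.
    by rewrite {2}(divn_eq n l) exprD (mulnC (n %/ l)%N l); ring.
  by rewrite dvdp_subr // dvdp_mull // dvdp_Xorder.
by rewrite leqNgt ltn_mod l_gt0.
Qed.

(** The variable is a unit modulo [K], its inverse being ['X^(l - 1)]. *)
Lemma dvdp_mulXn n P : K %| 'X^n * P -> K %| P.
Proof.
move=> h; have l_gt0 := Xorder_gt0.
have -> : P = 'X^(l * n - n) * ('X^n * P) - ('X^(l * n) - 1) * P.
  by rewrite mulrA -exprD subnK ?leq_pmull //; ring.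
by apply: dvdp_sub; [apply: dvdp_mull | apply/dvdp_mulr/dvdp_Xorder].
Qed.

Lemma dvdpN_Xn n : ~~ (K %| 'X^n).
Proof.
apply/negP; rewrite -['X^n]mulr1 => /dvdp_mulXn; rewrite dvdp1.
by case: (size K) K_gt1 => [|[]].
Qed.

End OrderOfX.

(** * Polynomials modulo which the variable has maximal order *)

Section Primitive.
Variables (F : finFieldType) (K : {poly F}) (r : nat).
Hypothesis (sK : size K = r.+1).
Let l := (#|F| ^ r - 1)%N.
Hypothesis (l_ord : least_positive (fun n => 'X^n %% K = 1 %% K) l).

Lemma primitive_size_gt1 : (1 < size K)%N.
Proof.
by have [] := l_ord; rewrite sK /l; case: r.
Qed.
Let K_gt1 := primitive_size_gt1.

(** Counting: reducing ['X^k] for [k < l] gives [#|F| ^ r - 1] distinct nonzero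
    remainders, which is the number of nonzero polynomials of size at most [r]. *)
Lemma primitive_dichotomy P : (K %| P) || [exists k : 'I_l, K %| P - 'X^k].
Proof.
have l_gt0 := Xorder_gt0 l_ord.
have sz (p : {poly F}) : (size (p %% K)%R <= r)%N.
  by rewrite -ltnS -sK ltn_modp -size_poly_eq0 sK.
pose f (k : 'I_l) : 'rV[F]_r := poly_rV ('X^k %% K).
have rV_inj (p q : {poly F}) : poly_rV (p %% K) = poly_rV (q %% K) :> 'rV[F]_r -> p %% K = q %% K.
  by move=> e; rewrite -(poly_rV_K (sz p)) e poly_rV_K.
have f_inj : injective f.
  have aux (i j : 'I_l) : (i <= j)%N -> f i = f j -> i = j.
    move=> ij /rV_inj/esym/eqmodp_dvd.
    rewrite -(subnKC ij) exprD -[X in _ - X]mulr1 -mulrBr.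
    move/(dvdp_mulXn l_ord)/(dvdp_Xsub1_order l_ord).
    rewrite /dvdn modn_small ?(leq_ltn_trans (leq_subr _ _)) // subn_eq0 => ji.
    by apply/val_inj/eqP; rewrite eqn_leq ij.
  move=> i j e; have [/aux->//|/ltnW/aux e'] := leqP i j.
  by rewrite e'.
have cf : f @: [set: 'I_l] = ~: [set 0].
  apply/eqP; rewrite eqEcard; apply/andP; split.
    apply/subsetP => _ /imsetP[i _ ->]; rewrite !inE; apply/negP => /eqP e.
    have /negP[] := dvdpN_Xn K_gt1 l_ord i.
    by rewrite -[X in _ %| X]subr0; apply/eqmodp_dvd/rV_inj; rewrite mod0p linear0.
  by rewrite card_imset // cardsT card_ord cardsC1 card_mx mul1n /l subn1.
have [//|nKP] := boolP (K %| P).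
have : poly_rV (P %% K) \in f @: [set: 'I_l].
  rewrite cf !inE; apply: contraNneq nKP => e.
  by rewrite -[P]subr0; apply/eqmodp_dvd/rV_inj; rewrite mod0p linear0.
case/imsetP => k _ /rV_inj/eqmodp_dvd h.
by apply/existsP; exists k.
Qed.

Lemma primitive_prime P R : K %| P * R -> (K %| P) || (K %| R).
Proof.
move=> h; have /orP[->//|/existsP[k hk]] := primitive_dichotomy P.
apply/orP; right; apply: (dvdp_mulXn l_ord (n := k)).
have -> : 'X^k * R = P * R - (P - 'X^k) * R by ring.
by rewrite dvdp_subr // dvdp_mulr.
Qed.
End Primitive.

(** * Reduction mod 2 *)

HB.instance Definition _ := GRing.RMorphism.copy red2 (map_poly (intr : int -> 'F_2)).

Lemma F2_cases (b : 'F_2) : b = 0 \/ b = 1.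
Proof. by case: b => [[|[|//]] h]; [left|right]; apply/val_inj. Qed.

Lemma odd_intP (a : int) : reflect (exists m, a = 1 + 2 * m) (odd_int a).
Proof.
rewrite /odd_int; apply: (iffP idP) => [h|[m ->]]; last by lia.
exists ((a - 1) %/ 2)%Z; lia.
Qed.

Lemma intrF2_odd (a : int) : (a%:~R : 'F_2) = (odd_int a)%:R.
Proof.
have two0 : 2%:~R = 0 :> 'F_2 by apply/val_inj.
have [/odd_intP[m ->]|h] := boolP (odd_int a).
  by rewrite intrD intrM two0 mul0r addr0.
have -> : a = 2 * (a %/ 2)%Z by move: h; rewrite /odd_int; lia.
by rewrite intrM two0 mul0r.
Qed.

Lemma red2C (a : int) : red2 a%:P = (odd_int a)%:R.
Proof. by rewrite /red2 map_polyC /= intrF2_odd polyC_natr. Qed.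

Lemma red2Xn n : red2 'X^n = 'X^n.
Proof. by rewrite /red2 map_polyXn. Qed.

Lemma red2X : red2 'X = 'X.
Proof. by rewrite /red2 map_polyX. Qed.

Lemma red2_eq0 (P : {poly int}) : red2 P = 0 -> exists U, P = 2 * U.
Proof.
move=> h; exists (\poly_(i < size P) (P`_i %/ 2)%Z).
have -> : 2 = 2%:P :> {poly int} by rewrite polyC_natr.
apply/polyP => i; rewrite coefCM coef_poly.
have : (red2 P)`_i = 0 by rewrite h coef0.
rewrite /red2 coef_map /= intrF2_odd /odd_int.
case: ltnP => [_|?]; last by rewrite nth_default.
by move: (P`_i) => a; case: (boolP (odd `|a|)) => //; lia.
Qed.

Lemma red2_surj p : exists P, red2 P = p.
Proof.
exists (map_poly (fun a : 'F_2 => (a : nat)%:Z) p).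
apply/polyP => i; rewrite /red2 coef_map /= coef_map_id0 //.
exact: (natr_Zp p`_i).
Qed.

Lemma red2_double (P : {poly int}) : red2 (2 * P) = 0.
Proof. by rewrite rmorphM /= -polyC_natr red2C mul0r. Qed.

(** Divisibility by [Q] mod 2 means membership in the ideal [(2, Q)]; this is the
    form in which identities over F_2 are lifted to exact ones over the
    integers. *)
Lemma red2_dvdP (Q P : {poly int}) :
  red2 Q %| red2 P -> exists U V, P = 2 * U + Q * V.
Proof.
move=> /dvdpP[v hv]; have [V hV] := red2_surj v.
have [U hU] : exists U, P - Q * V = 2 * U.
  by apply: red2_eq0; rewrite rmorphB rmorphM /= hv hV mulrC subrr.
by exists U, V; rewrite -hU; ring.
Qed.

(** Relations modulo [(4, Q)] may be halved: a factor 2 of [Q * V] has to come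
    from [V], because the polynomials over F_2 form a domain. *)
Lemma red2_divide2 (Q P V : {poly int}) :
  red2 Q != 0 -> 2 * P = Q * V -> red2 Q %| red2 P.
Proof.
move=> Q0 h; have : red2 (Q * V) = 0 by rewrite -h red2_double.
rewrite rmorphM => /eqP; rewrite mulf_eq0 (negPf Q0) /= => /eqP/red2_eq0[W hW].
have /(mulfI _)-> : 2 * P = 2 * (Q * W) by rewrite h hW; ring.
  by rewrite rmorphM dvdp_mulr.
by rewrite -polyC_natr polyC_eq0.
Qed.

Lemma frobenius_iter (x y : {poly 'F_2}) n :
  (x + y) ^+ (2 ^ n) = x ^+ (2 ^ n) + y ^+ (2 ^ n).
Proof.
apply: exprDn_pchar.
rewrite pnatX pnatE //; apply/orP; left.
rewrite pchar_poly; exact: pchar_Fp.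
Qed.

(** * The order of the variable modulo a primitive trinomial and powers of 2 *)

Lemma size_trinomial (R : idomainType) (a b c : R) (s r : nat) :
  (0 < s)%N -> (s < r)%N -> c != 0 ->
  size (a%:P + b *: 'X^s + c *: 'X^r) = r.+1.
Proof.
move=> s0 sr c0; rewrite addrC size_polyDl size_scale ?size_polyXn //.
rewrite ltnS (leq_trans (size_polyD _ _)) // geq_max.
rewrite (leq_trans (size_polyC_leq1 _)) 1?(leq_trans _ sr) //.
by rewrite (leq_trans (size_scale_leq _ _)) // size_polyXn.
Qed.

Lemma odd_int_neq0 (a : int) : odd_int a -> a != 0.
Proof. by case: eqP => // ->. Qed.

Lemma odd_intX (a : int) n : odd_int a -> odd_int (a ^+ n).
Proof. by rewrite /odd_int abszX oddX => ->; rewrite orbT. Qed.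

Lemma odd_addM (a b c : int) : odd_int a -> odd_int b -> odd_int c ->
  exists m, a * b + c = 2 * m.
Proof.
move=> /odd_intP[x ->] /odd_intP[y ->] /odd_intP[z ->].
by exists (1 + x + y + z + 2 * x * y); ring.
Qed.

Lemma polyC_double (m : int) : (2 * m)%:P = 2 * m%:P.
Proof. by rewrite polyCM (polyC_natr _ 2). Qed.

Lemma odd_polyC (a : int) : odd_int a -> exists m, a%:P = 1 + 2 * m :> {poly int}.
Proof. by case/odd_intP => m ->; exists m%:P; rewrite polyCD polyC_double polyC1. Qed.

(** Here [u ^ 2] and [v ^ 2] play the roles of [e1 * x] and [e2 * y] modulo
    [(4, Q)]. Squaring [a1 * u + a2 * v = 2 * C - a0] turns the congruence for
    [u] and [v] modulo 2 into
    [e1 * x + e2 * y + 2 * (a1 * a2 * u * v) = 1] modulo 4, as odd squares are 1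
    modulo 4. Multiplying by [a0] and adding [Q] removes the constant term and
    leaves only even coefficients. *)
Lemma square_descent (R : comNzRingType)
  (a0 a1 a2 m0 m1 m2 Q x y u v C D e1 e2 E1 F1 E2 F2 b c : R) :
  a0 = 1 + 2 * m0 -> a1 = 1 + 2 * m1 -> a2 = 1 + 2 * m2 ->
  Q = a0 + a1 * x + a2 * y -> a0 + a1 * u + a2 * v = 2 * C + Q * D ->
  u ^+ 2 = e1 * x + 4 * E1 + Q * F1 -> v ^+ 2 = e2 * y + 4 * E2 + Q * F2 ->
  a0 * e1 + a1 = 2 * b -> a0 * e2 + a2 = 2 * c ->
  exists E F, 2 * (b * x + c * y + a0 * a1 * a2 * (u * v) - 2 * E) = Q * F.
Proof.
move=> h0 h1 h2 hQ hC hu hv hb hc.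
exists (a0 * (C ^+ 2 - C * a0 + m0 + m0 ^+ 2 - (m1 + m1 ^+ 2) * u ^+ 2
   - (m2 + m2 ^+ 2) * v ^+ 2 - E1 - E2)).
exists (a0 * (Q * D ^+ 2 + 4 * C * D - 2 * a0 * D - F1 - F2) + 1).
apply/eqP; rewrite -subr_eq0; apply/eqP.
(* the difference is a combination of the hypotheses, the oddness ones being
   substituted by the final rewriting *)
transitivity (x * (2 * b - (a0 * e1 + a1)) + y * (2 * c - (a0 * e2 + a2))
  + a0 * (e1 * x + 4 * E1 + Q * F1 - u ^+ 2)
  + a0 * (e2 * y + 4 * E2 + Q * F2 - v ^+ 2)
  + (a0 + a1 * x + a2 * y - Q)
  + a0 * ((a0 + a1 * u + a2 * v) - (2 * C + Q * D))
       * (a1 * u + a2 * v + (2 * C + Q * D - a0))); last first.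
  by rewrite hb hc -hu -hv -hQ hC !subrr !(mulr0, mul0r) !addr0.
by rewrite h0 h1 h2; ring.
Qed.

Section Trinomial.
Variables (q0 qs qr : int) (r s : nat).
Hypotheses (hs : (0 < s)%N) (hsr : (s < r)%N) (hr : (2 < r)%N).
Hypotheses (hq0 : odd_int q0) (hqr : odd_int qr).
Let Q := trinomial q0 qs qr s r.
Let K := red2 Q.
Let l := (2 ^ r - 1)%N.
Hypothesis l_ord : least_positive (fun n => 'X^n %% K = 1 %% K) l.

Lemma red2_trinomial : K = 1 + (odd_int qs)%:R * 'X^s + 'X^r.
Proof.
rewrite /K /Q /trinomial -!mul_polyC !rmorphD !rmorphM /= !red2C !red2Xn.
by rewrite hq0 hqr mul1r.
Qed.

Lemma size_red2_trinomial : size K = r.+1.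
Proof.
rewrite red2_trinomial -[X in _ + X]scale1r -polyC1 -polyC_natr mul_polyC.
by rewrite size_trinomial // oner_neq0.
Qed.

Lemma order_gt_triple : (3 * (r - 1) < l)%N.
Proof.
rewrite /l; case: r hr => [|[|[|n]]] // _.
elim: n => // n IH; move: IH; rewrite (expnS 2 n.+3); lia.
Qed.

(** Otherwise [Q] would reduce to [1 + 'X^r], modulo which ['X] has order at most
    [r]. *)
Lemma odd_middle : odd_int qs.
Proof.
apply/negPn/negP => h; have := red2_trinomial.
rewrite (negPf h) mul0r addr0 => eK.
have /(dvdp_Xsub1_order l_ord) : K %| 'X^r - 1.
  have -> : 'X^r - 1 = K - 2 :> {poly 'F_2} by rewrite eK; ring.
  suff -> : 2 = 0 :> {poly 'F_2} by rewrite subr0.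
  by apply/eqP; rewrite -polyC_natr polyC_eq0.
move/dvdn_leq => /(_ (ltnW (ltnW hr))).
by have := order_gt_triple; lia.
Qed.

Lemma red2_trinomial1 : K = 1 + 'X^s + 'X^r.
Proof. by rewrite red2_trinomial odd_middle mul1r. Qed.

(** With [X = 'X^s] and [Y = 'X^r = 1 + X] mod [K], the form reduces to the unit
    [X * Y], [X] or [Y] unless [b] and [c] are both 1. In that last case it
    is [1 + X + X ^ 2], whose vanishing would make [X] a cube root of unity; as
    [3 s < l] this contradicts the order of ['X]. For [r = 2] and [s = 1] this
    case does occur. *)
Lemma quadratic_form_nonzero (b c : 'F_2) :
  ~~ (K %| b *: ('X^s) ^+ 2 + c *: ('X^r) ^+ 2 + 'X^s * 'X^r).
Proof.
have K_gt1 : (1 < size K)%N by rewrite size_red2_trinomial ltnS; lia.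
have eK := red2_trinomial1.
have nX := dvdpN_Xn K_gt1 l_ord.
have mX := dvdp_mulXn l_ord.
set X := 'X^s in eK *; set Y := 'X^r in eK *.
have eY : Y = K - 1 - X by rewrite eK; ring.
apply/negP.
case: (F2_cases b) => ->; case: (F2_cases c) => ->;
  rewrite ?scale0r ?scale1r ?add0r ?addr0.
- by move/mX/(negP (nX r)).
- have -> : Y ^+ 2 + X * Y = Y * K - Y by rewrite eK; ring.
  by rewrite dvdp_subr ?dvdp_mull // => /(negP (nX r)).
- have -> : X ^+ 2 + X * Y = X * K - X by rewrite eK; ring.
  by rewrite dvdp_subr ?dvdp_mull // => /(negP (nX s)).
move=> h; have : K %| X ^+ 3 - 1.
  have -> : X ^+ 3 - 1 = (X - 1) *
     (X ^+ 2 + Y ^+ 2 + X * Y - K * (K - 2 - X)) by rewrite eY; ring.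
  by rewrite dvdp_mull // dvdp_sub // dvdp_mulr.
rewrite /X -exprM => /(dvdp_Xsub1_order l_ord)/dvdn_leq.
have := order_gt_triple; lia.
Qed.

(** With ['X^l = 1 + 2 * A] modulo [Q], the values [e = 1] and [e = -1] rule out
    that [A], respectively [1 + A], vanishes mod [(2, Q)]. The point is that
    [e * 'X] would be the square of [u = 'X^(2 ^ r.-1)] modulo [(4, Q)], while [u]
    is a root of [Q] mod 2, so that the relation [Q(u) = 0] can be squared. *)
Lemma Xorder_not_scalar_mod4 (e : int) (U V : {poly int}) :
  odd_int e -> 'X^l <> e%:P + 4 * U + Q * V.
Proof.
move=> he hl.
pose N := (2 ^ r.-1)%N; pose u : {poly int} := 'X^N.
have lN : (N.*2 = l.+1)%N.
  by rewrite /N /l -mul2n -expnS prednK ?(ltnW (ltnW hr)) // subn1 prednK // expn_gt0.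
have u2 : u ^+ 2 = (e%:P + 4 * U + Q * V) * 'X.
  by rewrite -hl -exprM muln2 lN exprSr.
have ru : red2 u = 'X^N by rewrite red2Xn.
clearbody u.
(* [Q(u)] vanishes mod [(2, Q)] because it reduces to the [N]-th power of [K] *)
have [C [D hCD]] : exists C D, q0%:P + qs%:P * u ^+ s + qr%:P * u ^+ r = 2 * C + Q * D.
  apply: red2_dvdP; rewrite -/K.
  have -> : red2 (q0%:P + qs%:P * u ^+ s + qr%:P * u ^+ r) = K ^+ N.
    rewrite !rmorphD !rmorphM !rmorphXn /= !red2C hq0 odd_middle hqr !mul1r.
    rewrite ru red2_trinomial1 !frobenius_iter expr1n -!exprM.
    by rewrite !(mulnC N).
  by rewrite dvdp_exp // expn_gt0.
have pw n : exists E F, u ^+ n ^+ 2 = (e ^+ n)%:P * 'X^n + 4 * E + Q * F.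
  exists (U * 'X * \sum_(i < n) (u ^+ 2) ^+ (n.-1 - i) * (e%:P * 'X) ^+ i).
  exists (V * 'X * \sum_(i < n) (u ^+ 2) ^+ (n.-1 - i) * (e%:P * 'X) ^+ i).
  apply/eqP; rewrite -addrA addrC -subr_eq polyC_exp -exprMn exprAC subrXX u2.
  by apply/eqP; ring.
have [Es [Fs hEs]] := pw s; have [Er [Fr hEr]] := pw r.
have hqs := odd_middle.
have [b hb] := odd_addM hq0 (odd_intX s he) hqs.
have [c hc] := odd_addM hq0 (odd_intX r he) hqr.
have [m0 em0] := odd_polyC hq0; have [ms ems] := odd_polyC hqs.
have [mr emr] := odd_polyC hqr.
have hb' : q0%:P * (e ^+ s)%:P + qs%:P = 2 * b%:P by rewrite -polyCM -polyCD hb polyC_double.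
have hc' : q0%:P * (e ^+ r)%:P + qr%:P = 2 * c%:P by rewrite -polyCM -polyCD hc polyC_double.
have QE : Q = q0%:P + qs%:P * 'X^s + qr%:P * 'X^r by rewrite /Q /trinomial !mul_polyC.
have [E [F hEF]] := square_descent em0 ems emr QE hCD hEs hEr hb' hc'.
have K0 : red2 Q != 0 by rewrite -size_poly_eq0 -/K size_red2_trinomial.
have := red2_divide2 K0 hEF; rewrite -/K => hK.
have {hK} : K %| b%:~R *: 'X^s + c%:~R *: 'X^r + 'X^N ^+ s * 'X^N ^+ r.
  move: hK; rewrite rmorphB /= red2_double subr0 !rmorphD !rmorphM !rmorphXn /= ru.
  rewrite !red2C hq0 hqs hqr !mul1r !intrF2_odd -!mul_polyC !polyC_natr.
  by rewrite red2X.
(* squaring replaces ['X^N], which is [u] mod 2, by its square ['X^(l + 1)], that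
   is by ['X] *)
set T := _ + _ => hT.
have {hT} hT2 : K %| T ^+ (2 ^ 1) by rewrite dvdp_exp.
have /negP[] := quadratic_form_nonzero (b%:~R ^+ 2) (c%:~R ^+ 2).
move: hT2; rewrite /T !frobenius_iter !exprZn -!exprD -!exprM.
have -> : (N * (s + r) * 2 ^ 1 = l * (s + r) + (s + r))%N.
  by rewrite expn1 mulnAC muln2 lN mulSn addnC.
rewrite exprD => hT2.
set P := _ + 'X^(s + r).
have -> : P = P + ('X^(l * (s + r)) - 1) * 'X^(s + r)
             - ('X^(l * (s + r)) - 1) * 'X^(s + r) by ring.
apply: dvdp_sub; last by rewrite dvdp_mulr // (dvdp_Xorder l_ord).
by congr (K %| _): hT2; rewrite /P; ring.
Qed.

(** If [B] is the cofactor for [k], then the one for [k + 1] is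
    [B + 2 ^ k * B ^ 2]. Mod 2 this is [B] itself once [k] is positive, but
    [B * (1 + B)] for [k = 0]: hence the two values excluded for [A]. *)
Lemma Xorder_pow2 k : exists B V, 'X^(2 ^ k * l) = 1 + 2 ^+ k.+1 * B + Q * V
  /\ ~~ (K %| red2 B).
Proof.
have l_ord2 : least_positive (fun n => 'X^n %% K = 1 %% K) (#|'F_2| ^ r - 1)%N.
  by rewrite card_Fp.
have [A [V hA]] : exists A V, 'X^l - 1 = 2 * A + Q * V.
  by apply: red2_dvdP; rewrite rmorphB rmorph1 /= red2Xn -[l]muln1 dvdp_Xorder.
have {}hA : 'X^l = 1 + 2 * A + Q * V by rewrite -[LHS](subrK 1) hA; ring.
have nA : ~~ (K %| red2 A).
  apply/negP => /red2_dvdP[U [W eA]].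
  apply: (@Xorder_not_scalar_mod4 1 U (2 * W + V)) => //.
  by rewrite hA eA; ring.
have nA1 : ~~ (K %| red2 (1 + A)).
  apply/negP => /red2_dvdP[U [W eA]].
  apply: (@Xorder_not_scalar_mod4 (-1) U (2 * W + V)) => //.
  have -> : 'X^l = - 1 + 2 * (1 + A) + Q * V by rewrite hA; ring.
  by rewrite eA polyCN polyC1; ring.
case: k => [|k]; first by exists A, V; rewrite mul1n.
elim: k => [|k [B [W [hB nB]]]].
  exists (A * (1 + A)), (Q * V ^+ 2 + 2 * (1 + 2 * A) * V); split.
    by rewrite mulnC exprM hA; ring.
  rewrite rmorphM; apply/negP.
  by move/(primitive_prime size_red2_trinomial l_ord2); rewrite (negPf nA) (negPf nA1).
exists (B + 2 ^+ k.+1 * B ^+ 2), (Q * W ^+ 2 + 2 * (1 + 2 ^+ k.+2 * B) * W); split.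
  by rewrite expnS -mulnA mulnC exprM hB !(exprS _ k.+2) !(exprS _ k.+1); ring.
by rewrite rmorphD /= exprS -mulrA red2_double addr0.
Qed.
End Trinomial.

(** * The annihilator of an integer sequence *)

Section Annihilator.
Variable x : nat -> int.

Definition seqform (P : {poly int}) : int := \sum_(i < size P) P`_i * x i.

Lemma seqform_widen n (P : {poly int}) :
  (size P <= n)%N -> seqform P = \sum_(i < n) P`_i * x i.
Proof.
move=> h; rewrite /seqform (big_ord_widen n (fun i => P`_i * x i) h) big_mkcond.
by apply: eq_bigr => i _; case: ltnP => // ?; rewrite nth_default ?mul0r.
Qed.

Lemma seqform_linear a P R : seqform (a *: P + R) = a * seqform P + seqform R.
Proof.
pose n := maxn (size P) (size R).
have hP : (size P <= n)%N by apply: leq_maxl.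
have hR : (size R <= n)%N by apply: leq_maxr.
rewrite (seqform_widen hP) (seqform_widen hR) (@seqform_widen n); last first.
  rewrite (leq_trans (size_polyD _ _)) // geq_max hR andbT.
  by rewrite (leq_trans (size_scale_leq _ _)).
rewrite mulr_sumr -big_split; apply: eq_bigr => i _ /=.
by rewrite coefD coefZ; ring.
Qed.

Lemma seqformXn n : seqform 'X^n = x n.
Proof.
rewrite /seqform size_polyXn big_ord_recr /= coefXn eqxx mul1r big1 ?add0r //.
by move=> i _; rewrite coefXn ltn_eqF ?mul0r.
Qed.

Lemma seqform0 : seqform 0 = 0.
Proof. by rewrite /seqform size_poly0 big_ord0. Qed.

Lemma seqformD P R : seqform (P + R) = seqform P + seqform R.
Proof. by rewrite -[P in LHS]scale1r seqform_linear mul1r. Qed.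

Lemma seqformZ a P : seqform (a *: P) = a * seqform P.
Proof. by rewrite -[a *: P]addr0 seqform_linear seqform0 addr0. Qed.

(** Quantifying over all multiples [R * P] makes this an ideal by construction;
    with [R] a power of ['X] it says that [P], read as a polynomial in the shift
    operator, sends [x] to a sequence of multiples of [m]. *)
Definition annihilates (m : int) (P : {poly int}) : Prop :=
  forall R, (m %| seqform (R * P))%Z.

Lemma annD m P S : annihilates m P -> annihilates m S -> annihilates m (P + S).
Proof. by move=> hP hS R; rewrite mulrDr seqformD rpredD. Qed.

Lemma annMl m P S : annihilates m P -> annihilates m (S * P).
Proof. by move=> hP R; rewrite mulrA. Qed.

Lemma annMr m P S : annihilates m P -> annihilates m (P * S).
Proof. by rewrite mulrC; apply: annMl. Qed.

Lemma annB m P S : annihilates m P -> annihilates m S -> annihilates m (P - S).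
Proof. by move=> hP hS; rewrite -mulN1r; apply/annD/annMl. Qed.

Lemma ann_const m : annihilates m m%:P.
Proof. by move=> R; rewrite mulrC mul_polyC seqformZ dvdz_mulr. Qed.

Lemma ann_dvd d m P : (d %| m)%Z -> annihilates m P -> annihilates d P.
Proof. by move=> dm hP R; apply: dvdz_trans (hP R). Qed.

Lemma ann_div d m P : d != 0 -> annihilates (d * m) (d%:P * P) -> annihilates m P.
Proof.
move=> d0 h R; have := h R.
by rewrite mulrCA mul_polyC seqformZ dvdz_mul2l.
Qed.

Lemma annP m P : (forall n, (m %| seqform ('X^n * P))%Z) -> annihilates m P.
Proof.
move=> h R; rewrite -[R]mulr1 -(expr0 'X); move: 0%N.
elim/poly_ind: R => [|R c IH] n; first by rewrite !mul0r seqform0 dvdz0.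
have -> : (R * 'X + c%:P) * 'X^n * P = c%:P * ('X^n * P) + R * 'X^(n.+1) * P.
  by rewrite exprS; ring.
by rewrite mul_polyC seqform_linear rpredD ?IH // dvdz_mull.
Qed.

Lemma ann_XnXp1 m N p :
  annihilates m ('X^N * ('X^p - 1)) <->
  forall n, (N <= n)%N -> (x (n + p)%N = x n %[mod m])%Z.
Proof.
have E n : seqform ('X^n * ('X^N * ('X^p - 1))) = x (n + N + p)%N - x (n + N)%N.
  have -> : 'X^n * ('X^N * ('X^p - 1)) = (-1) *: 'X^(n + N) + 'X^(n + N + p)
    :> {poly int}.
    by rewrite !exprD -mul_polyC polyCN; ring.
  by rewrite seqform_linear !seqformXn; ring.
split=> [h n Nn|h].
  by apply/eqP; rewrite eqz_mod_dvd -(subnK Nn) -E.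
by apply: annP => n; rewrite E -eqz_mod_dvd h // leq_addl.
Qed.

End Annihilator.

Lemma ann_Xn_sub1_dvd x m a n :
  annihilates x m ('X^a - 1) -> (a %| n)%N -> annihilates x m ('X^n - 1).
Proof.
move=> ha /dvdnP[k ->].
by rewrite mulnC exprM -[X in _ - X](expr1n _ k) subrXX; apply: annMr.
Qed.

(** A polynomial that is nonzero mod [(2, Q)] is a power of ['X], hence a unit; if
    it annihilated [x] modulo 2, so would 1, and every term of [x] would be
    even. *)
Lemma ann_two_red2 (x : nat -> int) (r : nat) (Q P : {poly int}) :
  size (red2 Q) = r.+1 ->
  least_positive (fun n => 'X^n %% red2 Q = 1 %% red2 Q) (2 ^ r - 1) ->
  (exists i, odd_int (x i)) ->
  annihilates x 2 Q -> annihilates x 2 P -> red2 Q %| red2 P.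
Proof.
move=> sK l_ord [i xi] hQ hP.
have l_ord2 : least_positive (fun n => 'X^n %% red2 Q = 1 %% red2 Q)
   (#|'F_2| ^ r - 1)%N by rewrite card_Fp.
have [//|/existsP[k /= hk]] := orP (primitive_dichotomy sK l_ord2 (red2 P)).
have ann_red2 R : red2 Q %| red2 R -> annihilates x 2 R.
  move=> /red2_dvdP[U [V ->]]; apply: annD; last exact: annMr.
  by rewrite -(polyC_natr _ 2); apply/annMr/ann_const.
have hXk : annihilates x 2 'X^k.
  have -> : 'X^k = P - (P - 'X^k) by ring.
  by apply: annB => //; apply: ann_red2; rewrite rmorphB /= red2Xn.
have h1 : annihilates x 2 1.
  pose l := (2 ^ r - 1)%N; have l_gt0 : (0 < l)%N := Xorder_gt0 l_ord.
  have -> : 1 = 'X^(l * k - k) * 'X^k - ('X^(l * k) - 1) :> {poly int}.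
    by rewrite -exprD subnK ?leq_pmull //; ring.
  apply: annB; first exact: annMl.
  by apply: ann_red2; rewrite rmorphB rmorph1 /= red2Xn (dvdp_Xorder l_ord).
have := h1 'X^i; rewrite mulr1 seqformXn; move: xi; rewrite /odd_int.
lia.
Qed.

(** * The period *)

Theorem theorem3 (q0 qs qr : int) (r s : nat)
    (hs : (0 < s)%N) (hsr : (s < r)%N) (hr : (2 < r)%N)
    (hq0 : odd_int q0) (hqr : odd_int qr)
    (hprim : primitive_mod2 (trinomial q0 qs qr s r))
    (w : nat) (hw : (1 <= w)%N) (x : nat -> int)
    (hodd : exists i : nat, (i < r)%N /\ odd_int (x i))
    (hrec : forall n : nat,
       (q0 * x n + qs * x (n + s)%N + qr * x (n + r)%N = 0 %[mod 2 ^+ w])%Z) :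
  has_period (2 ^+ w) x (2 ^ (w - 1) * (2 ^ r - 1))%N.
Proof.
have [_ _] := hprim; rewrite size_trinomial ?odd_int_neq0 //= => l_ord.
have Xpow2 := Xorder_pow2 hs hsr hr hq0 hqr l_ord.
have sK := size_red2_trinomial qs hs hsr hq0 hqr.
have {}hodd : exists i, odd_int (x i) by case: hodd => i []; exists i.
case: w hw hrec => // v _ hrec; rewrite subSS subn0.
set Q := trinomial _ _ _ _ _ in l_ord Xpow2 sK *; set l := (2 ^ r - 1)%N in l_ord Xpow2 *.
set m := 2 ^+ v.+1.
have annQ : annihilates x m Q.
  apply: annP => n; rewrite /Q /trinomial.
  have -> : 'X^n * (q0%:P + qs *: 'X^s + qr *: 'X^r) =
      q0 *: 'X^n + (qs *: 'X^(n + s) + qr *: 'X^(n + r)) :> {poly int}.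
    by rewrite !exprD -!mul_polyC; ring.
  rewrite !(seqformD, seqformZ) !seqformXn addrA.
  by rewrite -[X in (_ %| X)%Z]subr0 -eqz_mod_dvd; apply/eqP/hrec.
have pow2C k : 2 ^+ k = (2 ^+ k)%:P :> {poly int}.
  by rewrite polyC_exp (polyC_natr _ 2).
have dvd2m : (2 %| m)%Z by rewrite /m exprS dvdz_mulr.
have annp : annihilates x m ('X^(2 ^ v * l) - 1).
  have [B [V [-> _]]] := Xpow2 v; rewrite -[1 + _ + _]addrA [1 + _]addrC addrK.
  by apply: annD; [rewrite pow2C; apply/annMr/ann_const | apply: annMr].
have p_gt0 : (0 < 2 ^ v * l)%N by rewrite muln_gt0 expn_gt0 (Xorder_gt0 l_ord).
split=> // [|p p_gt0' [N /ann_XnXp1 annNp]].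
  by exists 0%N; apply/ann_XnXp1; rewrite mul1r.
(* ['X] is invertible modulo the annihilator, so ['X^N] can be cancelled *)
have {annNp} annXp : annihilates x m ('X^p - 1).
  pose a := (2 ^ v * l * N)%N.
  have -> : 'X^p - 1 = 'X^(a - N) * ('X^N * ('X^p - 1)) - ('X^p - 1) * ('X^a - 1)
    :> {poly int}.
    by rewrite mulrA -exprD subnK ?leq_pmull //; ring.
  apply: annB; first exact: annMl.
  by apply/annMl/(ann_Xn_sub1_dvd annp)/dvdn_mulr.
have red2_ann P : annihilates x m P -> red2 Q %| red2 P.
  by move=> hP; apply: (ann_two_red2 sK l_ord hodd); apply: ann_dvd dvd2m _.
have /dvdnP[j ej] : (l %| p)%N.
  apply: (dvdp_Xsub1_order l_ord); have := red2_ann _ annXp.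
  by rewrite rmorphB rmorph1 /= red2Xn.
have j_gt0 : (0 < j)%N by move: p_gt0'; rewrite ej muln_gt0 => /andP[].
rewrite ej leq_mul2r; apply/orP; right.
have [o] := pfactor_coprime (p := 2) isT j_gt0; rewrite coprime2n => odd_o ejo.
case: (leqP v (logn 2 j)) => [vj | jv].
  by rewrite ejo (leq_trans _ (leq_pmull _ (odd_gt0 odd_o))) // leq_exp2l.
exfalso; pose u := v.-1.
have ev : v = u.+1 by rewrite prednK // (leq_trans _ jv).
pose T : {poly int} := 'X^(2 ^ u * l).
(* [T ^ 2] and [T ^ o] are both 1 modulo the annihilator, with [o] odd, hence so
   is [T] *)
have annT : annihilates x m (T - 1).
  have annTo : annihilates x m (T ^+ o - 1).
    rewrite /T -exprM; apply: (ann_Xn_sub1_dvd annXp).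
    have -> : p = (2 ^ logn 2 j * l * o)%N by rewrite ej {1}ejo -mulnA mulnC.
    by rewrite !dvdn_mul // dvdn_exp2l // -ltnS -ev.
  have -> : T - 1 = (T ^+ o - 1) - T * ('X^(2 ^ v * l * o./2) - 1).
    have -> : 'X^(2 ^ v * l * o./2) = T ^+ (o./2).*2 :> {poly int}.
      by rewrite /T -exprM ev expnS -muln2; congr ('X^ _); lia.
    by rewrite -{1}(odd_double_half o) odd_o exprS; ring.
  apply: annB => //; apply: annMl.
  exact/(ann_Xn_sub1_dvd annp)/dvdn_mulr.
have [B [V [eT nB]]] := Xpow2 u.
have annB2 : annihilates x 2 B.
  apply: (@ann_div x (2 ^+ v)); first by rewrite expf_neq0.
  rewrite -exprSr -pow2C.
  have -> : 2 ^+ v * B = (T - 1) - Q * V by rewrite /T eT ev; ring.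
  by apply: annB => //; apply: annMr.
by case/negP: nB; apply: (ann_two_red2 sK l_ord hodd) => //; apply: ann_dvd annQ.
Qed.
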